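(* Let $(X,d)$ be a metric space, $\mu$ a measure on $X$, $s\ge1$, and $p\in[1,\infty]$. Then $$\mathcal{M}^{s,p}(X)\hookrightarrow M^{1,p}(X).$$
   Context: $X_1\hookrightarrow X_2$ means $X_1\subseteq X_2$ with $\|f\|_{X_2}\le C\|f\|_{X_1}$ for some constant $C$ and all $f\in X_1$. Functions are real-valued and identified with their $\mu$-a.e. classes; $0\cdot\infty=0$. $[k]=\{1,\dots,k\}$, $[0]=\emptyset$. Let $k\in\mathbb{N}$, $s\in(k-1,k]$, $\mathbf{x}=\{x_I\}_{I\subseteq[k]}\subseteq X$. For nonempty $S\subseteq[k]$ and $A\subseteq[k]\setminus S$ put $$\mathsf{P}^S_A(\mathbf{x})=\sqrt{\tfrac12\Big|\sum_{I\subseteq S}\sum_{J\subseteq S}(-1)^{|S\setminus I|+|S\setminus J|}d(x_{A\cup I},x_{A\cup J})^2\Big|},\qquad \mathsf{P}^S(\mathbf{x})=\sum_{A\subseteq[k]\setminus S}\mathsf{P}^S_A(\mathbf{x});$$ for $j\in[k-1]$, $\mathsf{P}^j(\mathbf{x})=\sum_{\mathcal{P}}\prod_{S\in\mathcal{P}}\mathsf{P}^S(\mathbf{x})$, the sum over partitions $\mathcal{P}$ of $[k]$ into exactly $j$ nonempty blocks; $\mathsf{P}^s(\mathbf{x})=\mathsf{P}^{\{k\}}(\mathbf{x})^{s-k+1}\prod_{j=1}^{k-1}\mathsf{P}^{\{j\}}(\mathbf{x})$; $\mathsf{P}^{\langle s\rangle}(\mathbf{x})=\mathsf{P}^s(\mathbf{x})+\sum_{j=1}^{k-1}\mathsf{P}^j(\mathbf{x})$.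 For measurable $f\colon X\to\mathbb{R}$, $\mathbb{D}^s_\mu(f)$ is the family of measurable $G\colon X\to[0,\infty]$ for which there is a set $F\subseteq X$ of full measure such that $|\sum_{I\subseteq[k]}(-1)^{|[k]\setminus I|}f(x_I)|\le\mathsf{P}^{\langle s\rangle}(\mathbf{x})\sum_{I\subseteq[k]}G(x_I)$ for all tuples $\mathbf{x}=\{x_I\}_{I\subseteq[k]}\subseteq F$. $\mathcal{M}^{s,p}(X)=\mathcal{M}^{s,p}(X,d,\mu)$ is the set of $f\in L^p(X,\mu)$ for which there is $G\in\mathbb{D}^s_\mu(f)\cap L^p(X,\mu)$, with norm $\|f\|_{L^p(X)}+\inf_{G\in\mathbb{D}^s_\mu(f)}\|G\|_{L^p(X)}$. $M^{1,p}(X)$ is the Hajłasz–Sobolev space: all $f\in L^p(X,\mu)$ having a Hajłasz gradient $g\in L^p(X,\mu)$, i.e. a measurable $g\ge0$ with $|f(x)-f(y)|\le d(x,y)(g(x)+g(y))$ for all $x,y$ in some set of full measure; its norm is $\|f\|_{L^p}+\inf_g\|g\|_{L^p}$ over Hajłasz gradients $g$ of $f$. *)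

(* Defs.v *)
From HB Require Import structures.
From mathcomp Require Import all_boot all_order all_algebra.
From mathcomp Require Import all_classical all_reals all_analysis.
From mathcomp Require Import measurable_realfun.

Set Implicit Arguments.
Unset Strict Implicit.
Unset Printing Implicit Defensive.

Import Order.TTheory GRing.Theory Num.Theory.
Import numFieldNormedType.Exports.

Local Open Scope ring_scope.

(* A metric space with a sigma-algebra. No compatibility between the two is
   imposed, so Borel sigma-algebras and their completions are included. *)
#[short(type="measurableMetricType")]
HB.structure Definition MeasurableMetric (d : measure_display)
    (R : numDomainType) :=
  {X of Measurable d X & Metric R X}.

(* [k] = {1, .., k} is represented by 'I_k, with j : 'I_k standing for j + 1;
   a tuple {x_I}_{I \subset [k]} is a function x : {set 'I_k} -> X. *)
Section P_functionals.
Context {R : realType} {X : metricType R} {k : nat}.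
Implicit Types (x : {set 'I_k} -> X) (A S : {set 'I_k}).

Definition PSA S A x : R :=
  Num.sqrt (2^-1 *
    `| \sum_(I : {set 'I_k} | I \subset S) \sum_(J : {set 'I_k} | J \subset S)
         (-1) ^+ (#|S :\: I| + #|S :\: J|)
         * mdist (x (A :|: I)) (x (A :|: J)) ^+ 2 |).

Definition PS S x : R := \sum_(A : {set 'I_k} | A \subset ~: S) PSA S A x.

Definition Ppart (j : nat) x : R :=
  \sum_(Q : {set {set 'I_k}} | finset.partition Q [set: 'I_k] && (#|Q| == j))
    \prod_(S in Q) PS S x.

(* The first product has a single factor, indexed by the last element of [k]. *)
Definition Ptop (s : R) x : R :=
  (\prod_(j < k | j.+1 == k) PS [set j] x `^ (s - k%:R + 1))
  * \prod_(j < k | (j.+1 < k)%N) PS [set j] x.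

Definition Pfull (s : R) x : R := Ptop s x + \sum_(1 <= j < k) Ppart j x.

Definition altsum (f : X -> R) x : R :=
  \sum_(I : {set 'I_k}) (-1) ^+ #|~: I| * f (x I).

End P_functionals.

(* The integer k with k - 1 < s <= k. *)
Definition order_of {R : realType} (s : R) : nat := `|Num.ceil s|%N.

Lemma order_of_itv {R : realType} (s : R) : 0 < s ->
  (order_of s)%:R - 1 < s <= (order_of s)%:R.
Proof.
move=> s0; have c0 : 0 <= Num.ceil s by rewrite ceil_ge0 (lt_trans _ s0) ?ltrN10.
have -> : (order_of s)%:R = (Num.ceil s)%:~R :> R.
  by rewrite /order_of natr_absz ger0_norm.
by have := ceil_itv s; rewrite rmorphB.
Qed.

(* Spaces are given as sets of functions rather than of a.e. classes; membership
   and norms below depend on the a.e. class only. *)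
Local Open Scope classical_set_scope.

Section spaces.
Context {R : realType} {d : measure_display} {X : measurableMetricType d R}.
Variable mu : {measure set X -> \bar R}.
Implicit Types (f : X -> R) (s : R) (p : \bar R).

Definition Dgrad s f : set (X -> \bar R) :=
  [set G : X -> \bar R | [/\ measurable_fun [set: X] G, forall z, (0 <= G z)%E &
    exists2 F : set X, mu.-negligible (~` F) &
      forall x : {set 'I_(order_of s)} -> X, (forall I, F (x I)) ->
        (`|altsum f x|%:E
         <= (Pfull s x)%:E * \sum_(I : {set 'I_(order_of s)}) G (x I))%E ]].

Definition calM s p : set (X -> R) :=
  [set f : X -> R | f \in Lfun mu p /\
    exists2 G, Dgrad s f G & ('N[mu]_p[G] < +oo)%E].

Definition calM_norm s p f : \bar R :=
  ('N[mu]_p[EFin \o f] + ereal_inf [set 'N[mu]_p[G] | G in Dgrad s f])%E.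

Definition hajlasz_grad f : set (X -> R) :=
  [set g : X -> R | [/\ measurable_fun [set: X] g, forall z, 0 <= g z &
    exists2 F : set X, mu.-negligible (~` F) &
      forall x y, F x -> F y -> `|f x - f y| <= mdist x y * (g x + g y) ]].

Definition hajlaszM p : set (X -> R) :=
  [set f : X -> R | f \in Lfun mu p /\ exists2 g, hajlasz_grad f g & g \in Lfun mu p].

Definition hajlaszM_norm p f : \bar R :=
  ('N[mu]_p[EFin \o f]
   + ereal_inf [set 'N[mu]_p[EFin \o g] | g in hajlasz_grad f])%E.

End spaces.

Definition embeds {R : realType} {T : Type} (V1 : set T) (N1 : T -> \bar R)
    (V2 : set T) (N2 : T -> \bar R) : Prop :=
  V1 `<=` V2 /\
  exists C : R, forall f, V1 f -> (N2 f <= C%:E * N1 f)%E.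

(* Main.v *)
Require Import Defs.
From mathcomp Require Import all_boot all_order all_algebra.
From mathcomp Require Import all_classical all_reals all_analysis.
From mathcomp Require Import measurable_realfun.
From mathcomp Require Import ring lra.

(** The embedding comes from testing the defining inequality of [Dgrad] on the
    tuples with only two values: [x_I = a] for [I] empty and [x_I = b] for every
    other [I].

    Since the signs [(-1)^|~: I|] sum to zero over the subsets of [[k]], the
    alternating sum of such a tuple collapses to [f a - f b], up to sign
    ([altsum_two_point]).  On the other side, each [PS S] is at most a constant
    times the diameter [D] of the tuple, here [D = d(a, b)].  Every term of
    [Pfull s] is homogeneous in the [PS S]: of degree [j >= 1] for [Ppart j],
    and of degree [(s - k + 1) + (k - 1) = s >= 1] for [Ptop s].  Hence, when
    [D <= 1], every term is at most a constant times [D]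
    ([Pfull_le_diam]), and a gradient [G] of order [s] gives
    [|f a - f b| <= C d(a, b) (G a + G b)] for [d(a, b) <= 1].

    For [d(a, b) >= 1] the trivial bound [|f a - f b| <= |f a| + |f b|] already
    has the required form.  So [C (|f| + G)] is a Hajlasz gradient of [f]
    ([Dgrad_hajlasz_grad]), and Minkowski's inequality bounds its norm by
    [C (||f||_p + ||G||_p)] ([Dgrad_hajlasz_Lnorm]).

    As [G] may take the value [+oo], it is replaced by [fine (G x)], which
    agrees with it off a null set because [||G||_p] is finite. *)

Set Implicit Arguments.
Unset Strict Implicit.
Unset Printing Implicit Defensive.

Import Order.TTheory GRing.Theory Num.Theory.

Local Open Scope ring_scope.

(** * Bounds on the P-functionals by the diameter of the tuple *)

Lemma sum_const_powerset (R : pzSemiRingType) (k : nat) (D : R) :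
  \sum_(I : {set 'I_k}) D = (2 ^ k)%:R * D.
Proof.
rewrite big_const iter_addr_0 mulr_natl; congr (_ *+ _).
by rewrite -cardsT -powersetT card_powerset cardsT card_ord.
Qed.

Section diameter_bounds.
Context {R : realType} {X : metricType R} {k : nat}.
Implicit Types (x : {set 'I_k} -> X) (A S : {set 'I_k}) (D s : R).

Lemma PSA_ge0 S A x : 0 <= PSA S A x.
Proof. exact: sqrtr_ge0. Qed.

Lemma PS_ge0 S x : 0 <= PS S x.
Proof. by apply: sumr_ge0 => A _; exact: PSA_ge0. Qed.

(** The double sum has at most [(2 ^ k) ^ 2] terms, each at most [D ^ 2]. *)
Lemma PSA_le_diam S A x D : 0 <= D -> (forall I J, mdist (x I) (x J) <= D) ->
  PSA S A x <= (2 ^ k)%:R * D.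
Proof.
move=> D0 xD; have kD0 : 0 <= (2 ^ k)%:R * D by rewrite mulr_ge0.
rewrite -[leRHS]ger0_norm// -sqrtr_sqr /PSA; apply: ler_wsqrtr.
apply: (@le_trans _ _ (1 * ((2 ^ k)%:R * D) ^+ 2)); last by rewrite mul1r.
apply: ler_pM => //; first by rewrite invf_le1 ?ler1n.
have -> : ((2 ^ k)%:R * D) ^+ 2 =
    \sum_(I : {set 'I_k}) \sum_(J : {set 'I_k}) D ^+ 2.
  by rewrite !sum_const_powerset exprMn expr2 mulrA.
apply: (le_trans (ler_norm_sum _ _ _)); rewrite big_mkcond/=.
apply: ler_sum => I _; case: ifP => _; last first.
  by apply: sumr_ge0 => J _; exact: sqr_ge0.
apply: (le_trans (ler_norm_sum _ _ _)); rewrite big_mkcond/=.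
apply: ler_sum => J _; case: ifP => _; last exact: sqr_ge0.
rewrite normrM normrX normrN1 expr1n mul1r normrX ler_sqr ?nnegrE//.
by rewrite ger0_norm ?mdist_ge0.
Qed.

Lemma PS_le_diam S x D : 0 <= D -> (forall I J, mdist (x I) (x J) <= D) ->
  PS S x <= (2 ^ k)%:R ^+ 2 * D.
Proof.
move=> D0 xD; rewrite expr2 -mulrA -sum_const_powerset /PS big_mkcond/=.
apply: ler_sum => A _; case: ifP => _; first exact: PSA_le_diam.
by rewrite mulr_ge0.
Qed.

Lemma Ppart_le (j : nat) x (M : R) : (forall S, PS S x <= M) ->
  Ppart j x <= #|{set {set 'I_k}}|%:R * M ^+ j.
Proof.
move=> PM; have M0 : 0 <= M := le_trans (PS_ge0 finset.set0 x) (PM _).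
apply: (@le_trans _ _ (\sum_(Q : {set {set 'I_k}}) M ^+ j)); last first.
  by rewrite big_const iter_addr_0 mulr_natl.
rewrite /Ppart big_mkcond/=; apply: ler_sum => Q _.
case: ifP => [/andP[_ /eqP <-]|_]; last exact: exprn_ge0.
by rewrite -prodr_const; apply: ler_prod => S _; rewrite PS_ge0 PM.
Qed.

(** The exponents of [Ptop] add up to [s]: only the whole product, and not its
    first factor with exponent [s - k + 1], need have degree at least [1]. *)
Lemma Ptop_le s x (M : R) : (0 < k)%N -> k%:R - 1 < s -> 1 <= s ->
  (forall S, PS S x <= M) -> Ptop s x <= M `^ s.
Proof.
move=> k_gt0 ks s1 PM.
have M0 : 0 <= M := le_trans (PS_ge0 finset.set0 x) (PM _).
have last_ltk : (k.-1 < k)%N by rewrite prednK.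
pose last := Ordinal last_ltk.
rewrite /Ptop (big_pred1 last); last first.
  by move=> j; rewrite /= -val_eqE/= -[in RHS]eqSS prednK.
have sE : s = (s - k%:R + 1) + k.-1%:R.
  by rewrite -[in k%:R](prednK k_gt0) -natr1; ring.
rewrite (eq_bigl (predC1 last)) => [|j]; last first.
  by rewrite inE/= -val_eqE/= ltn_neqAle ltn_ord andbT -[in RHS]eqSS prednK.
rewrite [in leRHS]sE [in leRHS]powRD; last by apply/implyP => /eqP s0; lra.
apply: ler_pM; rewrite ?powR_ge0//.
- by apply: prodr_ge0 => j _; exact: PS_ge0.
- by apply: ge0_ler_powR; rewrite ?nnegrE ?PS_ge0//; lra.
rewrite powR_mulrn// -[in leRHS](card_ord k) -(cardC1 last) -prodr_const.
by apply: ler_prod => j _; rewrite PS_ge0 PM.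
Qed.

(** All the terms of [Pfull] are homogeneous of degree at least [1], so that for
    tuples of diameter [D <= 1] the linear bound dominates them all. *)
Lemma Pfull_le_diam s : (0 < k)%N -> k%:R - 1 < s -> 1 <= s ->
  exists2 B : R, 0 <= B & forall x D, 0 <= D <= 1 ->
    (forall I J, mdist (x I) (x J) <= D) -> Pfull s x <= B * D.
Proof.
move=> k_gt0 ks s1; pose c : R := (2 ^ k)%:R ^+ 2.
have c0 : 0 <= c by exact: exprn_ge0.
pose N : R := #|{set {set 'I_k}}|%:R.
exists (c `^ s + \sum_(1 <= j < k) N * c ^+ j).
  rewrite addr_ge0 ?powR_ge0// sumr_ge0// => j _.
  by rewrite mulr_ge0 ?exprn_ge0.
move=> x D /andP[D0 D1] xD.
have PM S : PS S x <= c * D by exact: PS_le_diam.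
rewrite mulrDl; apply: lerD.
  apply: le_trans (Ptop_le k_gt0 ks s1 PM) _.
  rewrite powRM// ler_wpM2l ?powR_ge0//.
  have [->|D_neq0] := eqVneq D 0; first by rewrite powR0// gt_eqF//; lra.
  by apply: ge1r_powR => //; rewrite lt0r D_neq0 D0.
rewrite mulr_suml !big_nat; apply: ler_sum => j /andP[j1 _].
apply: le_trans (Ppart_le _ PM) _.
rewrite -mulrA ler_wpM2l// exprMn ler_wpM2l ?exprn_ge0//.
by rewrite -[leRHS]expr1 ler_wiXn2l.
Qed.

End diameter_bounds.

(** * Two-point tuples *)

Definition two_point {T : Type} {k : nat} (a b : T) (I : {set 'I_k}) : T :=
  if I == finset.set0 then a else b.

(** The expansion of the product of [k] factors [1 + -1]. *)
Lemma sum_signs_eq0 (R : comPzRingType) (k : nat) : (0 < k)%N ->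
  \sum_(I : {set 'I_k}) (-1) ^+ #|~: I| = 0 :> R.
Proof.
move=> k_gt0.
transitivity (\prod_(i < k) (1 + -1 : R)).
  rewrite bigA_distr; apply: eq_bigr => I _.
  rewrite -prodr_const big_mkcond/=; apply: eq_bigr => i _.
  by rewrite inE; case: (i \in I).
by rewrite subrr prodr_const card_ord expr0n eqn0Ngt k_gt0.
Qed.

(** As the signs cancel, the nonempty sets carry together the opposite of the
    sign of the empty set. *)
Lemma altsum_two_point (R : realType) (X : metricType R) (k : nat)
    (f : X -> R) (a b : X) : (0 < k)%N ->
  altsum f (@two_point X k a b) = (-1) ^+ k * (f a - f b).
Proof.
move=> k_gt0.
have sign0 : (-1) ^+ #|~: (finset.set0 : {set 'I_k})| = (-1) ^+ k :> R.
  by rewrite finset.setC0 cardsT card_ord.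
have := sum_signs_eq0 R k_gt0.
rewrite (bigD1 finset.set0)//= sign0 => /eqP.
rewrite addrC addr_eq0 => /eqP signs.
rewrite /altsum (bigD1 finset.set0)//= sign0 {1}/two_point eqxx.
under eq_bigr => I I_neq0 do rewrite /two_point (negbTE I_neq0).
by rewrite -mulr_suml signs; ring.
Qed.

(** * Monotonicity and a.e. finiteness for Lp norms *)

Section Lnorm_facts.
Context {d : measure_display} {T : measurableType d} {R : realType}.
Variable mu : {measure set T -> \bar R}.
Implicit Types (f g : T -> \bar R) (p : \bar R).
Local Open Scope ereal_scope.

Lemma le_Lnorm f g p : 0 <= p ->
  measurable_fun [set: T] f -> measurable_fun [set: T] g ->
  (forall x, `|f x| <= `|g x|) -> 'N[mu]_p[f] <= 'N[mu]_p[g].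
Proof.
move=> p0 mf mg fg; rewrite unlock /Lnorm; case: p p0 => [r|_|//].
  rewrite lee_fin => r0; have Ige0 h : 0 <= \int[mu]_x `|h x| `^ r.
    by apply: integral_ge0 => x _; exact: poweR_ge0.
  have mpow h : measurable_fun [set: T] h ->
      measurable_fun [set: T] (fun x => `|h x| `^ r).
    move=> mh; apply: (measurableT_comp (measurable_poweR r)).
    exact: measurableT_comp.
  apply: gt0_ler_poweR; rewrite ?invr_ge0 ?in_itv/= ?Ige0 ?leey//.
  apply: ge0_le_integral => //; [|exact: mpow|exact: mpow|].
    by move=> x _; exact: poweR_ge0.
  by move=> x _; apply: gt0_ler_poweR; rewrite ?in_itv/= ?abse_ge0 ?leey.
by case: ifPn => // _; apply: ess_sup_inf.le_ess_sup; exact: nearW.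
Qed.

Lemma Lnorm_lty_ae_fin_num f p : 0 < p -> measurable_fun [set: T] f ->
  'N[mu]_p[f] < +oo -> {ae mu, forall x, f x \is a fin_num}.
Proof.
move=> p0 mf; rewrite unlock /Lnorm; case: p p0 => [r|_|//].
  rewrite lte_fin => r0 /lty_poweRy; rewrite invr_eq0 gt_eqF// => /(_ isT) ifin.
  have : mu.-integrable [set: T] (fun x => `|f x| `^ r).
    apply/integrableP; split.
      apply: (measurableT_comp (measurable_poweR r)).
      exact: measurableT_comp.
    by under eq_integral => x _ do rewrite gee0_abs ?poweR_ge0//.
  move=> /(integrable_ae measurableT); apply: filterS => x /(_ I).
  by case: (f x) => //=; rewrite gt_eqF.
case: ifPn => [_ fin|mu0 _]; last first.
  (* The whole space is a null set. *)
  exists setT; split => //; apply/eqP.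
  by rewrite eq_le measure_ge0 leNgt mu0.
apply: filterS (ess_sup_inf.ess_sup_ge mu (abse \o f)) => x /= fx.
by rewrite fin_num_abs (le_lt_trans fx).
Qed.

End Lnorm_facts.

(** * Hajlasz gradients from gradients of order s *)

Section hajlasz_from_Dgrad.
Context {R : realType} {d : measure_display} {X : measurableMetricType d R}.
Variables (mu : {measure set X -> \bar R}) (s : R).
Context (s1 : 1 <= s).
Implicit Types (f : X -> R) (G : X -> \bar R) (p : \bar R).
Local Open Scope classical_set_scope.

(** Small scales: the defining inequality of [Dgrad] on two-point tuples, whose
    diameter is [mdist a b]. *)
Lemma Dgrad_small_scale : exists2 B : R, 0 <= B & forall f G, Dgrad mu s f G ->
  exists2 F : set X, mu.-negligible (~` F) & forall a b, F a -> F b ->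
    G a \is a fin_num -> G b \is a fin_num -> mdist a b <= 1 ->
    `|f a - f b| <= mdist a b * (B * (fine (G a) + fine (G b))).
Proof.
have s0 : 0 < s := lt_le_trans ltr01 s1.
have /andP[ks _] := order_of_itv s0.
have k_gt0 : (0 < order_of s)%N.
  by rewrite -(ltr_nat R) (lt_le_trans s0)//; have /andP[] := order_of_itv s0.
have [B B0 PB] := @Pfull_le_diam R X _ s k_gt0 ks s1.
set k := order_of s in k_gt0 ks PB.
(* [2 ^ k] counts the entries [G (x_I)], each at most [G a + G b]. *)
exists (B * (2 ^ k)%:R) => [|f G [_ G0 [F negF Ff]]]; first by rewrite mulr_ge0.
exists F => // a b Fa Fb Ga Gb ab1.
pose x := @two_point X k a b.
have diam I J : mdist (x I) (x J) <= mdist a b.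
  rewrite /x /two_point; case: ifP => _; case: ifP => _;
    by rewrite ?mdistxx ?mdist_ge0// metric_sym.
have {diam} Px := PB x _ (introT andP (conj (mdist_ge0 a b) ab1)) diam.
have Fx I : F (x I) by rewrite /x /two_point; case: ifP.
have Gx I : G (x I) \is a fin_num by rewrite /x /two_point; case: ifP.
have fineG0 z : 0 <= fine (G z) by exact: fine_ge0.
have := Ff x Fx; rewrite altsum_two_point// normrM normrX normrN1 expr1n mul1r.
rewrite -(EFin_sum_fine _ (fun I _ => Gx I)) -EFinM lee_fin => /le_trans; apply.
have sumG : \sum_I fine (G (x I)) <= (2 ^ k)%:R * (fine (G a) + fine (G b)).
  rewrite -sum_const_powerset; apply: ler_sum => I _.
  by rewrite /x /two_point; case: ifP => _; rewrite ?lerDl ?lerDr.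
apply: le_trans (ler_wpM2r _ Px) _; first by apply: sumr_ge0.
rewrite (mulrC B) -!mulrA ler_wpM2l ?mdist_ge0//.
by rewrite ler_wpM2l.
Qed.

(** [G] alone controls [f] at distances at most [1], and [|f|] alone controls it
    at distances at least [1]. *)
Lemma Dgrad_hajlasz_grad : exists2 C : R, 0 < C & forall f G,
  measurable_fun setT f -> Dgrad mu s f G ->
  {ae mu, forall x, G x \is a fin_num} ->
  hajlasz_grad mu f (fun x => C * (`|f x| + fine (G x))).
Proof.
have [B B0 small] := Dgrad_small_scale.
exists (1 + B) => [|f G mf DG Gfin]; first exact: ltr_pwDl.
have C0 : 0 <= 1 + B by rewrite addr_ge0.
have [F negF Ff] := small f G DG; have [mG G0 _] := DG.
have fineG0 z : 0 <= fine (G z) by exact: fine_ge0.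
split.
- apply: measurable_funM => //; apply: measurable_funD.
    exact: measurableT_comp.
  by apply: measurableT_comp.
- by move=> z; rewrite mulr_ge0 ?addr_ge0.
exists (F `&` [set x | G x \is a fin_num]).
  by rewrite setCI; exact: negligibleU.
move=> a b [Fa Ga] [Fb Gb].
have [ab1|/ltW ab1] := leP (mdist a b) 1.
  apply: le_trans (Ff _ _ Fa Fb Ga Gb ab1) _; rewrite ler_wpM2l ?mdist_ge0//.
  have := normr_ge0 (f a); have := normr_ge0 (f b).
  by have := fineG0 a; have := fineG0 b; nra.
apply: le_trans (ler_normB _ _) _.
rewrite -[leLHS]mul1r; apply: ler_pM; rewrite ?addr_ge0//.
have := normr_ge0 (f a); have := normr_ge0 (f b).
by have := fineG0 a; have := fineG0 b; nra.
Qed.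

(** As [C] is uniform in [f] and [G], this bound passes to the infima that
    define the two norms. *)
Lemma Dgrad_hajlasz_Lnorm p : (1 <= p)%E ->
  exists2 C : R, 0 < C & forall f G,
    f \in Lfun mu p -> Dgrad mu s f G -> ('N[mu]_p[G] < +oo)%E ->
  exists g, [/\ hajlasz_grad mu f g, g \in Lfun mu p &
    ('N[mu]_p[EFin \o g] <= C%:E * ('N[mu]_p[EFin \o f] + 'N[mu]_p[G]))%E].
Proof.
move=> p1; have p0 : (0 < p)%E by exact: lt_le_trans p1.
have [C C0 grad] := Dgrad_hajlasz_grad.
exists C => // f G fL DG Goo.
have /andP[+ +] := fL; rewrite !inE/= => mf foo; have [mG G0 _] := DG.
pose u x := `|f x|; pose v x := fine (G x).
have mabs : measurable_fun setT u by exact: measurableT_comp.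
have mv : measurable_fun setT v by exact: measurableT_comp.
have Nu : 'N[mu]_p[EFin \o u]%E = 'N[mu]_p[EFin \o f]%E.
  by rewrite -[RHS]Lnorm_abse.
have Nv : ('N[mu]_p[EFin \o v] <= 'N[mu]_p[G])%E.
  apply: le_Lnorm => //; [exact: ltW|exact/measurable_EFinP|].
  by move=> x; rewrite /v/=; case: (G x) => //= *; rewrite ?leey// normr0.
have uL : u \in Lfun mu p by apply/andP; rewrite !inE/= /finite_norm Nu.
have vL : v \in Lfun mu p.
  by apply/andP; rewrite !inE/= /finite_norm (le_lt_trans Nv).
have uvL : (u \+ v) \in Lfun mu p by exact: rpredD.
exists (C \*: (u \+ v)); split.
- exact: grad (Lnorm_lty_ae_fin_num p0 mG Goo).
- exact: (rpredZ C uvL).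
- have := LnormZ (Lfun_Sub p1 uvL) C; rewrite /= => ->.
  rewrite gtr0_norm// lee_pmul2l// ?lte_fin//.
  by apply: le_trans (eminkowski mu mabs mv p1) _; rewrite Nu leeD2l.
Qed.

End hajlasz_from_Dgrad.

Theorem theorem5p7 (R : realType) (d : measure_display)
    (X : measurableMetricType d R) (mu : {measure set X -> \bar R})
    (s : R) (p : \bar R) (hs : 1 <= s) (hp : (1 <= p)%E) :
  embeds (calM mu s p) (calM_norm mu s p) (hajlaszM mu p) (hajlaszM_norm mu p).
Proof.
have [C C0 grad] := Dgrad_hajlasz_Lnorm mu hs hp.
split=> [f [fL [G DG Goo]]|].
  have [g [gf gL _]] := grad f G fL DG Goo.
  by split => //; exists g.
exists (1 + C) => f [fL _]; rewrite /hajlaszM_norm /calM_norm.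
have /andP[_ +] := fL; rewrite inE/= => foo.
have fN : ('N[mu]_p[EFin \o f])%E \is a fin_num.
  by rewrite ge0_fin_numE ?Lnorm_ge0.
set Nf := ('N[mu]_p[EFin \o f])%E in foo fN *.
set inf_g := ereal_inf _; set inf_G := ereal_inf _.
have inf_G0 : (0 <= inf_G)%E.
  by apply/ereal_infP => _ [G _ <-]; exact: Lnorm_ge0.
have le_inf : (inf_g <= C%:E * (Nf + inf_G))%E.
  rewrite -lee_pdivrMl// -leeBlDl//; apply/ereal_infP => _ [G DG <-].
  rewrite leeBlDl// lee_pdivrMl//.
  have [->|] := eqVneq 'N[mu]_p[G]%E +oo%E.
    by rewrite addey ?gt0_muley ?lte_fin ?leey//; case: (Nf) fN.
  rewrite -ltey => Goo; have [g [gf _ gN]] := grad f G fL DG Goo.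
  by apply: le_trans gN; apply: ereal_inf_lbound; exists g.
rewrite EFinD ge0_muleDl//; last by rewrite lee_fin ltW.
rewrite mul1e.
by apply: leeD => //; exact: leeDl.
Qed.
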